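(* Let $\bar x\in X$, let $\bar y\in S(\bar x)$ be inner non-degenerate, let $\bar x$ be a stationary (with $\bar y$) and outer non-degenerate point of the minmax problem $(P)$, and let $Q_{11}'|_{T(\bar x,X)}$ be positive definite. Then $\bar z=(\bar x,\bar y)$ is a local saddle point of $f$ on $\Omega$.
   Context: Setting. Let $Q_{11}\in\mathbb{R}^{n\times n}$, $Q_{22}\in\mathbb{R}^{m\times m}$ be symmetric positive semidefinite, $Q_{12}\in\mathbb{R}^{n\times m}$, $c_x\in\mathbb{R}^n$, $c_y\in\mathbb{R}^m$, $A_O\in\mathbb{R}^{p\times n}$, $b_O\in\mathbb{R}^p$, $A_I\in\mathbb{R}^{q\times n}$, $B_I\in\mathbb{R}^{q\times m}$, $b_I\in\mathbb{R}^q$ with $p<n$, $q<m$. Put $f(x,y)=\frac12x^\top Q_{11}x+x^\top Q_{12}y-\frac12y^\top Q_{22}y+c_x^\top x+c_y^\top y$, $X=\{x: A_Ox=b_O,\ x\ge0\}$, $Y(x)=\{y: A_Ix+B_Iy=b_I,\ y\ge0\}$, $\Omega=\{(x,y): x\in X,\ y\in Y(x)\}$. Problem $(P)$: $\min_{x\in X}\max_{y\in Y(x)}f(x,y)$. $S(x)=\arg\max_{y\in Y(x)}f(x,y)$; standing assumption: $S(x)\neq\emptyset$ for all $x\in X$. With $$Q=\begin{bmatrix}Q_{11}&Q_{12} \\ Q_{12}^\top&-Q_{22}\end{bmatrix},\ c=\begin{bmatrix}c_x \\ c_y\end{bmatrix},\ A=\begin{bmatrix}A_O&0 \\ A_I&B_I\end{bmatrix},\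 b=\begin{bmatrix}b_O \\ b_I\end{bmatrix}$$ one has $f(z)=\frac12z^\top Qz+c^\top z$ for $z=(x,y)$ and $\Omega=\{z: Az=b,z\ge0\}$. Stationarity. $\bar x\in X$ is stationary for $(P)$ with $\bar y\in S(\bar x)$ and multipliers $(\bar\lambda_O,\bar s_O,\bar\lambda_I,\bar s_I)$ if ($\circ$ componentwise product) $Q_{11}\bar x+Q_{12}\bar y+c_x+A_I^\top\bar\lambda_I+A_O^\top\bar\lambda_O-\bar s_O=0$, $A_O\bar x-b_O=0$, $\bar x\circ\bar s_O=0$, $\bar x,\bar s_O\ge0$, and $-Q_{22}\bar y+Q_{12}^\top\bar x+c_y+B_I^\top\bar\lambda_I+\bar s_I=0$, $A_I\bar x+B_I\bar y-b_I=0$, $\bar y\circ\bar s_I=0$, $\bar y,\bar s_I\ge0$ (inner KKT system). Non-degeneracy. $\mathcal I_{\bar x}=\{i:\bar x_i=0\}$, $\mathcal I_{\bar y}=\{j:\bar y_j=0\}$; $E_{\bar x}$, $E_{\bar y}$ are the matrices with rows $(e_n^i)^\top$, $i\in\mathcal I_{\bar x}$, and $(e_m^j)^\top$, $j\in\mathcal I_{\bar y}$. For symmetric $M$ and a subspace $T$, $M|_T=N^\top MN$ with the columns of $N$ a basis of $T$ (for $T=\{0\}$ the empty matrix, regarded as nonsingular and definite). $T(\bar x,X)=\ker\begin{bmatrix}A_O \\ E_{\bar x}\end{bmatrix}$, $T(\bar y,Y(\bar x))=\ker\begin{bmatrix}B_I \\ E_{\bar y}\end{bmatrix}$. $\bar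 y\in S(\bar x)$ is inner non-degenerate if: ILICQ ($[B_I^\top,E_{\bar y}^\top]$ has full column rank), ISCS ($\min_i([\bar s_I]_i+\bar y_i)>0$ for the then unique inner multiplier $\bar s_I$), and ISOSC ($\eta^\top(-Q_{22})\eta<0$ for all $\eta\in T(\bar y,Y(\bar x))\setminus\{0\}$). In this case define $$Q_{11}'=Q_{11}-\begin{bmatrix}Q_{12}&A_I^\top&0\end{bmatrix}\begin{bmatrix}-Q_{22}&B_I^\top&E_{\bar y}^\top \\ B_I&0&0 \\ E_{\bar y}&0&0\end{bmatrix}^{-1}\begin{bmatrix}Q_{12}^\top \\ A_I \\ 0\end{bmatrix}.$$ A stationary point $\bar x$ with inner non-degenerate $\bar y$ is outer non-degenerate if: OLICQ ($[A_O^\top,E_{\bar x}^\top]$ has full column rank), OSCS ($\min_i([\bar s_O]_i+\bar x_i)>0$), and OSORC ($Q_{11}'|_{T(\bar x,X)}$ is nonsingular). Saddle points. $\bar z\in\Omega$ is a critical point of $f$ on $\Omega$ if there are $\bar\lambda\in\mathbb{R}^{p+q}$, $\bar\sigma\in\mathbb{R}^{n+m}$ (no sign restriction) with $Q\bar z+c+A^\top\bar\lambda+\bar\sigma=0$, $A\bar z=b$, $\bar z\circ\bar\sigma=0$. It is a local saddle point of $f$ on $\Omega$ if it is a critical point but neither a local minimal nor a local maximal point of $f$ on $\Omega$. *)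

(* Defs.v *)
From mathcomp Require Import all_boot all_order all_algebra.
From mathcomp Require Import all_classical all_reals all_analysis.
From mathcomp Require Import ring.
Set Implicit Arguments.
Unset Strict Implicit.
Unset Printing Implicit Defensive.
Import Order.TTheory GRing.Theory Num.Theory.
Import numFieldNormedType.Exports.
Local Open Scope classical_set_scope.
Local Open Scope ring_scope.

Definition quad_form (R : realType) (n : nat) (M : 'M[R]_n) (v : 'cV[R]_n) : R :=
  (v^T *m M *m v) 0 0.

Definition dotp (R : realType) (n : nat) (u v : 'cV[R]_n) : R :=
  (u^T *m v) 0 0.

Definition sym_possemidef (R : realType) (n : nat) (M : 'M[R]_n) : Prop :=
  M^T = M /\ forall v : 'cV[R]_n, 0 <= quad_form M v.

Definition posdef (R : realType) (n : nat) (M : 'M[R]_n) : Prop :=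
  forall v : 'cV[R]_n, v != 0 -> 0 < quad_form M v.

Definition nonneg (R : realType) (n : nat) (v : 'cV[R]_n) : Prop :=
  forall i, 0 <= v i 0.

Definition hadamard (R : realType) (n : nat) (u v : 'cV[R]_n) : 'cV[R]_n :=
  map2_mx *%R u v.

Definition full_col_rank (R : realType) (m n : nat) (M : 'M[R]_(m, n)) : Prop :=
  \rank M = n.

(* The column kernel {v | M *m v = 0}; MathComp's kermx is the row kernel. *)
Definition colker (R : realType) (m n : nat) (M : 'M[R]_(m, n)) :
    {vspace 'cV[R]_n} :=
  lker (linfun (mulmx M : 'cV[R]_n -> 'cV[R]_m)).

Lemma mem_colker (R : realType) (m n : nat) (M : 'M[R]_(m, n)) (v : 'cV[R]_n) :
  (v \in colker M) = (M *m v == 0).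
Proof. by rewrite memv_ker lfunE. Qed.

Definition basis_mx (R : realType) (n : nat) (T : {vspace 'cV[R]_n}) :
    'M[R]_(n, \dim T) :=
  \matrix_(i, j) (vbasis T)`_j i 0.

(* M|_T = N^T M N, where N is the matrix whose columns are the library's chosen
   basis of T; another basis gives a congruent matrix.  For T = 0 this is the
   0 x 0 matrix, which belongs to unitmx and satisfies posdef. *)
Definition restrict_form (R : realType) (n : nat) (M : 'M[R]_n)
    (T : {vspace 'cV[R]_n}) : 'M[R]_(\dim T) :=
  (basis_mx T)^T *m M *m basis_mx T.

Definition active (R : realType) (n : nat) (v : 'cV[R]_n) : {set 'I_n} :=
  [set i | v i 0 == 0]%SET.

(* The rows of active_mx v are the unit vectors (e_n^i)^T, i in active v. *)
Definition active_mx (R : realType) (n : nat) (v : 'cV[R]_n) :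
    'M[R]_(#|active v|, n) :=
  rowsub (fun k : 'I_#|active v| => enum_val k) 1%:M.

Record minmaxQP (R : realType) (n m p q : nat) := MinmaxQP {
  Q11 : 'M[R]_n;
  Q12 : 'M[R]_(n, m);
  Q22 : 'M[R]_m;
  cx : 'cV[R]_n;
  cy : 'cV[R]_m;
  AO : 'M[R]_(p, n);
  bO : 'cV[R]_p;
  AI : 'M[R]_(q, n);
  BI : 'M[R]_(q, m);
  bI : 'cV[R]_q }.

Section Problem.
Context (R : realType) (n m p q : nat) (P : minmaxQP R n m p q).
Implicit Types (x : 'cV[R]_n) (y : 'cV[R]_m) (z : 'cV[R]_(n + m)).

Definition objective x y : R :=
  2^-1 * quad_form (Q11 P) x + (x^T *m Q12 P *m y) 0 0
  - 2^-1 * quad_form (Q22 P) y + dotp (cx P) x + dotp (cy P) y.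

Definition feasX : set 'cV[R]_n := [set x | AO P *m x = bO P /\ nonneg x].

Definition feasY x : set 'cV[R]_m :=
  [set y | AI P *m x + BI P *m y = bI P /\ nonneg y].

Definition argmaxY x : set 'cV[R]_m :=
  [set y | feasY x y /\
    forall y', feasY x y' -> objective x y' <= objective x y].

Definition Omega : set 'cV[R]_(n + m) :=
  [set z | feasX (usubmx z) /\ feasY (usubmx z) (dsubmx z)].

Definition objz z : R := objective (usubmx z) (dsubmx z).

Definition Qmx : 'M[R]_(n + m) :=
  block_mx (Q11 P) (Q12 P) (Q12 P)^T (- Q22 P).
Definition cvec : 'cV[R]_(n + m) := col_mx (cx P) (cy P).
Definition Amx : 'M[R]_(p + q, n + m) := block_mx (AO P) 0 (AI P) (BI P).
Definition bvec : 'cV[R]_(p + q) := col_mx (bO P) (bI P).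

Definition outer_system x y (lO : 'cV[R]_p) (sO : 'cV[R]_n) (lI : 'cV[R]_q) :
    Prop :=
  [/\ Q11 P *m x + Q12 P *m y + cx P + (AI P)^T *m lI + (AO P)^T *m lO - sO = 0,
      AO P *m x - bO P = 0,
      hadamard x sO = 0,
      nonneg x & nonneg sO].

Definition inner_KKT x y (lI : 'cV[R]_q) (sI : 'cV[R]_m) : Prop :=
  [/\ - Q22 P *m y + (Q12 P)^T *m x + cy P + (BI P)^T *m lI + sI = 0,
      AI P *m x + BI P *m y - bI P = 0,
      hadamard y sI = 0,
      nonneg y & nonneg sI].

Definition stationary_with x y (lO : 'cV[R]_p) (sO : 'cV[R]_n)
    (lI : 'cV[R]_q) (sI : 'cV[R]_m) : Prop :=
  [/\ feasX x, argmaxY x y, outer_system x y lO sO lI & inner_KKT x y lI sI].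

Definition stationary x y : Prop :=
  exists lO sO lI sI, stationary_with x y lO sO lI sI.

Definition tangentX x : {vspace 'cV[R]_n} :=
  colker (col_mx (AO P) (active_mx x)).

Definition tangentY y : {vspace 'cV[R]_m} :=
  colker (col_mx (BI P) (active_mx y)).

Definition ILICQ y : Prop := full_col_rank (row_mx (BI P)^T (active_mx y)^T).

(* The inner multiplier is unique under ILICQ, so this existential speaks about
   that multiplier; the same remark applies to OSCS, under ILICQ and OLICQ. *)
Definition ISCS x y : Prop :=
  exists lI sI, inner_KKT x y lI sI /\ forall j, 0 < sI j 0 + y j 0.

Definition ISOSC y : Prop :=
  forall eta, eta \in tangentY y -> eta != 0 -> quad_form (- Q22 P) eta < 0.

Definition inner_nondegenerate x y : Prop :=
  [/\ argmaxY x y, ILICQ y, ISCS x y & ISOSC y].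

Definition inner_KKT_mx y : 'M[R]_(m + (q + #|active y|)) :=
  block_mx (- Q22 P) (row_mx (BI P)^T (active_mx y)^T)
           (col_mx (BI P) (active_mx y)) 0.

Definition Q11' y : 'M[R]_n :=
  Q11 P - row_mx (Q12 P) (row_mx (AI P)^T 0)
          *m invmx (inner_KKT_mx y)
          *m col_mx (Q12 P)^T (col_mx (AI P) 0).

Definition OLICQ x : Prop := full_col_rank (row_mx (AO P)^T (active_mx x)^T).

Definition OSCS x y : Prop :=
  exists lO sO lI sI,
    stationary_with x y lO sO lI sI /\ forall i, 0 < sO i 0 + x i 0.

Definition OSORC x y : Prop := restrict_form (Q11' y) (tangentX x) \in unitmx.

Definition outer_nondegenerate x y : Prop :=
  [/\ stationary x y, inner_nondegenerate x y,
      OLICQ x, OSCS x y & OSORC x y].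

Definition critical_point z : Prop :=
  Omega z /\
  exists (l : 'cV[R]_(p + q)) (s : 'cV[R]_(n + m)),
    [/\ Qmx *m z + cvec + Amx^T *m l + s = 0,
        Amx *m z = bvec & hadamard z s = 0].

Definition local_minimal z : Prop :=
  Omega z /\ \forall w \near within Omega (nbhs z), objz z <= objz w.

Definition local_maximal z : Prop :=
  Omega z /\ \forall w \near within Omega (nbhs z), objz w <= objz z.

Definition local_saddle z : Prop :=
  [/\ critical_point z, ~ local_minimal z & ~ local_maximal z].

Lemma objzE z : objz z = 2^-1 * quad_form Qmx z + dotp cvec z.
Proof.
rewrite -[z]vsubmxK /objz col_mxKu col_mxKd /objective /quad_form /dotp /Qmx /cvec.
move: (usubmx z) (dsubmx z) => x y.
rewrite -!mulmxA mul_block_col !tr_col_mx !mul_row_col !mulmxDr mulNmx mulmxN.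
have -> : y^T *m ((Q12 P)^T *m x) = x^T *m (Q12 P *m y).
  by rewrite [RHS]mx11_scalar -tr_scalar_mx -mx11_scalar !trmx_mul trmxK mulmxA.
rewrite !mxE; set a := \sum_j _; set b := \sum_j _; set c := \sum_j _.
by field.
Qed.

Lemma OmegaE z : Omega z <-> Amx *m z = bvec /\ nonneg z.
Proof.
rewrite -[z]vsubmxK /Omega /feasX /feasY /= !col_mxKu !col_mxKd /Amx /bvec.
move: (usubmx z) (dsubmx z) => x y.
rewrite mul_block_col mul0mx addr0; split.
  move=> [[-> x0] [-> y0]]; split=> // k.
  by case: (split_ordP k) => j ->; rewrite ?col_mxEu ?col_mxEd.
move=> [/eq_col_mx[-> ->] xy0]; split; split=> // k.
  by have := xy0 (lshift m k); rewrite col_mxEu.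
by have := xy0 (rshift n k); rewrite col_mxEd.
Qed.

End Problem.

(* Main.v *)
Require Import Defs.
From mathcomp Require Import all_boot all_order all_algebra.
From mathcomp Require Import all_classical all_reals all_analysis.
From mathcomp Require Import ring lra.

(** Two rays out of the point [z = (x, y)] decide the matter: one inside [Omega]
along which [f] strictly increases, which excludes a local maximum, and one
along which [f] strictly decreases, which excludes a local minimum.
Criticality of [z] is read off the stationarity system, with multipliers
[(lO, lI)] and [(- sO, sI)].

Since [f] is quadratic, [f (z + t d) - f z = t g + t^2 / 2 h], where [g] is the
slope and [h = d^T Q d].  A ray escapes as soon as [g] has the right sign, or
[g = 0] and [h] has it.  When [d] is in the kernel of the constraint matrix,
the multipliers give [g = - s^T d], so that only the coordinates where [z]
vanishes contribute.

The directions come from [escape_direction], used for both players.  If the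
point has a vanishing coordinate, LICQ lets one leave all the active bounds at
unit speed without leaving the equality constraints, and strict
complementarity makes the slope nonzero.  If it has none, the tangent space is
the kernel of the equality constraints, nonzero because there are fewer
constraints than variables, and the slope is zero along it.

For the minimum, one moves [y] alone: the slope is negative, or else the
second-order condition of the inner problem makes [h] negative.  For the
maximum, one moves [x] along some [xi] and lets [y] follow by the [eta] that
the inner KKT matrix attaches to [xi]: it keeps the equality constraints and
the active bounds of [y], and the quadratic form of [Q] at [(xi, eta)] is that
of the Schur complement [Q11'] at [xi] ([schur_lift]).  Hence the slope is
positive, or else [xi] is tangent and the positive definiteness of [Q11']
makes [h] positive.  The inner KKT matrix is invertible by ILICQ and ISOSC
([saddle_mx_unit]). *)

Set Implicit Arguments.
Unset Strict Implicit.
Unset Printing Implicit Defensive.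
Import Order.TTheory GRing.Theory Num.Theory.
Import numFieldNormedType.Exports.
Local Open Scope classical_set_scope.
Local Open Scope ring_scope.

(** * Quadratic functions and feasible rays *)

Lemma bilinear_form_tr (R : realType) n m (u : 'cV[R]_n) (M : 'M[R]_(n, m))
    (v : 'cV[R]_m) :
  (u^T *m M *m v) 0 0 = (v^T *m M^T *m u) 0 0.
Proof.
have -> : v^T *m M^T *m u = (u^T *m M *m v)^T by rewrite !trmx_mul trmxK mulmxA.
by rewrite [RHS]mxE.
Qed.

Lemma quad_form_ray (R : realType) n (M : 'M[R]_n) (c z d : 'cV[R]_n) (t : R) :
  M^T = M ->
  2^-1 * quad_form M (z + t *: d) + dotp c (z + t *: d) =
  2^-1 * quad_form M z + dotp c z
  + (t * dotp (M *m z + c) d + t ^+ 2 / 2 * quad_form M d).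
Proof.
move=> symM; rewrite /quad_form /dotp.
have -> : (z + t *: d)^T = z^T + t *: d^T by rewrite linearD linearZ.
have -> : (M *m z + c)^T = z^T *m M + c^T by rewrite linearD /= trmx_mul symM.
rewrite !(mulmxDl, mulmxDr) ?(=^~ scalemxAl, =^~ scalemxAr).
have := bilinear_form_tr d M z; rewrite symM.
move: (d^T *m M *m z) (z^T *m M *m d) (z^T *m M *m z) (d^T *m M *m d)
  (c^T *m z) (c^T *m d) => a b e f g h.
rewrite !mxE => ->; field; by [].
Qed.

Lemma near0_mulr_lt (R : realType) (a b : R) :
  0 < a -> \forall t \near 0^'+, t * `|b| < a.
Proof.
move=> a0; near=> t.
have t0 : 0 < t by near: t; exact: nbhs_right_gt.
have b1 : 0 < `|b| + 1 by rewrite ltr_wpDl.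
have : t < a / (`|b| + 1) by near: t; apply: nbhs_right_lt; exact: divr_gt0.
by rewrite ltr_pdivlMr // mulrDr mulr1; lra.
Unshelve. all: by end_near.
Qed.

Lemma quadratic_gt0_near0 (R : realType) (g h : R) :
  0 < g \/ g = 0 /\ 0 < h ->
  \forall t \near 0^'+, 0 < t * g + t ^+ 2 / 2 * h.
Proof.
case=> [g0|[-> h0]]; near=> t.
- have t0 : 0 < t by near: t; exact: nbhs_right_gt.
  have tg : t * `|h| < g by near: t; exact: near0_mulr_lt.
  have -> : t * g + t ^+ 2 / 2 * h = t * (g + t * h / 2) by field; by [].
  apply: mulr_gt0 => //.
  have : - (t * `|h|) <= t * h by rewrite -mulrN ler_pM2l // lerNnormlW.
  by lra.
- have t0 : 0 < t by near: t; exact: nbhs_right_gt.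
  by rewrite mulr0 add0r; apply: mulr_gt0 => //; rewrite divr_gt0 ?exprn_gt0.
Unshelve. all: by end_near.
Qed.

(** At a feasible [z] this is the tangent cone of [Omega]; because [Omega] is a
polyhedron, each of its directions can be followed for a short time. *)
Definition feasible_dir (R : realType) n m p q (P : minmaxQP R n m p q)
    (z d : 'cV[R]_(n + m)) : Prop :=
  Amx P *m d = 0 /\ forall i, z i 0 = 0 -> 0 <= d i 0.

Lemma cvg_ray (R : realType) k (z d : 'cV[R]_k) : z + t *: d @[t --> 0^'+] --> z.
Proof.
have cij i : z i 0 + t * d i 0 @[t --> 0^'+] --> z i 0.
  rewrite -[X in _ --> X]addr0; apply: cvgD; first exact: cvg_cst.
  rewrite -[X in _ --> X](mul0r (d i 0)); apply: cvgMl.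
  exact/cvg_at_right_filter.
move=> A [B Bz sBA].
have : \forall t \near 0^'+, forall i, B i 0 (z i 0 + t * d i 0).
  by apply: filter_forall => i; apply: cij; exact: Bz.
apply: filterS => t Bt; apply: sBA => i j.
by rewrite ord1 !mxE; exact: Bt.
Qed.

Lemma near_feasible_ray (R : realType) n m p q (P : minmaxQP R n m p q)
    (z d : 'cV[R]_(n + m)) :
  Omega P z -> feasible_dir P z d ->
  \forall t \near 0^'+, Omega P (z + t *: d).
Proof.
move=> /OmegaE[Az z0] [Ad d0].
have : \forall t \near 0^'+, forall i, 0 <= z i 0 + t * d i 0.
  apply: filter_forall => i.
  have [zi|zi] := eqVneq (z i 0) 0.
    apply: filterS (nbhs_right_ge 0) => t t0.
    by rewrite zi add0r mulr_ge0 ?d0.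
  have zi0 : 0 < z i 0 by rewrite lt_neqAle eq_sym zi z0.
  apply: filterS2 (nbhs_right_gt 0) (near0_mulr_lt (d i 0) zi0) => t t0 td.
  have : - (t * `|d i 0|) <= t * d i 0.
    by rewrite -mulrN ler_pM2l // lerNnormlW.
  by lra.
apply: filterS => t zt; apply/OmegaE; split.
  by rewrite mulmxDr -scalemxAr Ad scaler0 addr0.
by move=> i; rewrite !mxE.
Qed.

(** What holds near [z] in [Omega] holds along the initial segment of each
feasible ray; this is how the two local extremality conditions are refuted. *)
Lemma near_ray (R : realType) n m p q (P : minmaxQP R n m p q)
    (z d : 'cV[R]_(n + m)) (A : set 'cV[R]_(n + m)) :
  Omega P z -> feasible_dir P z d ->
  (\forall w \near within (Omega P) (nbhs z), A w) ->
  \forall t \near 0^'+, A (z + t *: d).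
Proof.
move=> zO zd; rewrite near_withinE => zA.
have nA : \forall t \near 0^'+, Omega P (z + t *: d) -> A (z + t *: d).
  exact: (@cvg_ray _ _ z d _ zA).
by apply: filterS2 nA (near_feasible_ray zO zd) => t; apply.
Qed.

Lemma objz_ray (R : realType) n m p q (P : minmaxQP R n m p q)
    (z d : 'cV[R]_(n + m)) (t : R) :
  (Qmx P)^T = Qmx P ->
  objz P (z + t *: d) = objz P z
  + (t * dotp (Qmx P *m z + cvec P) d + t ^+ 2 / 2 * quad_form (Qmx P) d).
Proof. by move=> symQ; rewrite !objzE; exact: quad_form_ray. Qed.

Lemma not_local_maximal_of_ascent (R : realType) n m p q
    (P : minmaxQP R n m p q) (z d : 'cV[R]_(n + m)) :
  (Qmx P)^T = Qmx P -> feasible_dir P z d ->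
  0 < dotp (Qmx P *m z + cvec P) d \/
    dotp (Qmx P *m z + cvec P) d = 0 /\ 0 < quad_form (Qmx P) d ->
  ~ local_maximal P z.
Proof.
move=> symQ zd /quadratic_gt0_near0 up [zO zmax].
have dn := near_ray zO zd zmax.
have [t []] := filter_ex (filterI up dn).
by rewrite objz_ray // gerDl => ?; rewrite leNgt => /negP.
Qed.

Lemma not_local_minimal_of_descent (R : realType) n m p q
    (P : minmaxQP R n m p q) (z d : 'cV[R]_(n + m)) :
  (Qmx P)^T = Qmx P -> feasible_dir P z d ->
  dotp (Qmx P *m z + cvec P) d < 0 \/
    dotp (Qmx P *m z + cvec P) d = 0 /\ quad_form (Qmx P) d < 0 ->
  ~ local_minimal P z.
Proof.
move=> symQ zd gh [zO zmin].
have up := near_ray zO zd zmin.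
have /quadratic_gt0_near0 dn : 0 < - dotp (Qmx P *m z + cvec P) d \/
    - dotp (Qmx P *m z + cvec P) d = 0 /\ 0 < - quad_form (Qmx P) d.
  by rewrite !oppr_gt0; case: gh => [|[->]]; [left|right; rewrite oppr0].
have [t []] := filter_ex (filterI up dn).
by rewrite objz_ray // lerDl !mulrN -opprD oppr_gt0 => ?; rewrite ltNge => /negP.
Qed.

(** * Multipliers and complementarity *)

Lemma dotpE (R : realType) n (u v : 'cV[R]_n) : dotp u v = \sum_i u i 0 * v i 0.
Proof. by rewrite /dotp mxE; apply: eq_bigr => i _; rewrite mxE. Qed.

Lemma dotp_col_mx (R : realType) n m (u1 v1 : 'cV[R]_n) (u2 v2 : 'cV[R]_m) :
  dotp (col_mx u1 u2) (col_mx v1 v2) = dotp u1 v1 + dotp u2 v2.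
Proof. by rewrite /dotp tr_col_mx mul_row_col mxE. Qed.

(** The multiplier of an equality constraint does not contribute to the slope
along the kernel of that constraint. *)
Lemma dotp_multiplier (R : realType) k n (A : 'M[R]_(k, n)) (l : 'cV[R]_k)
    (g s d : 'cV[R]_n) :
  g + A^T *m l + s = 0 -> A *m d = 0 -> dotp g d = - dotp s d.
Proof.
move=> /eqP; rewrite -addrA addr_eq0 => /eqP -> Ad.
rewrite /dotp linearN linearD /= trmx_mul trmxK mulNmx mulmxDl.
by rewrite -mulmxA Ad mulmx0 add0r mxE.
Qed.

Lemma active_mxE (R : realType) n (v d : 'cV[R]_n) i :
  v i 0 = 0 -> exists k, (active_mx v *m d) k 0 = d i 0.
Proof.
move=> vi; have ia : i \in active v by rewrite inE vi.
exists (enum_rank_in ia i).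
by rewrite mul_rowsub_mx mul1mx mxE enum_rankK_in.
Qed.

Lemma active_mx_eq0 (R : realType) n (v d : 'cV[R]_n) i :
  active_mx v *m d = 0 -> v i 0 = 0 -> d i 0 = 0.
Proof. by move=> vd0 /(active_mxE d)[k <-]; rewrite vd0 mxE. Qed.

Lemma hadamard_eq0 (R : realType) n (u v : 'cV[R]_n) i :
  hadamard u v = 0 -> u i 0 = 0 \/ v i 0 = 0.
Proof.
move=> /(congr1 (fun w : 'cV_n => w i 0)) /eqP.
by rewrite !mxE mulf_eq0 => /orP[/eqP|/eqP]; [left|right].
Qed.

Lemma dotp_complementary (R : realType) n (v s d : 'cV[R]_n) :
  hadamard v s = 0 -> (forall i, v i 0 = 0 -> d i 0 = 0) -> dotp s d = 0.
Proof.
move=> vs d0; rewrite dotpE big1 // => i _.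
by case: (hadamard_eq0 i vs) => [/d0|] ->; rewrite ?mulr0 ?mul0r.
Qed.

Lemma col_mx_row_free (R : realType) k l n (A : 'M[R]_(k, n)) (B : 'M[R]_(l, n)) :
  full_col_rank (row_mx A^T B^T) -> row_free (col_mx A B).
Proof. by move=> AB; rewrite /row_free -mxrank_tr tr_col_mx AB. Qed.

(** With a vanishing coordinate, [col_mx A (active_mx v)] has a right inverse by
LICQ, which gives a direction leaving all the active bounds at unit speed; the
first alternative is then strict complementarity.  With no vanishing
coordinate, the second alternative is a nonzero vector of the kernel of [A]. *)
Lemma escape_direction (R : realType) k n (A : 'M[R]_(k, n)) (v s : 'cV[R]_n) :
  (k < n)%N -> full_col_rank (row_mx A^T (active_mx v)^T) ->
  hadamard v s = 0 -> (forall i, 0 < s i 0 + v i 0) ->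
  exists d, [/\ A *m d = 0, forall i, v i 0 = 0 -> 0 <= d i 0 &
    0 < dotp s d \/
    [/\ dotp s d = 0, d != 0 & d \in colker (col_mx A (active_mx v))]].
Proof.
move=> ltkn /col_mx_row_free Afree vs sv.
have [[i vi]|v_neq0] := pselect (exists i, v i 0 = 0).
- have [N AN] := row_freeP Afree.
  pose d : 'cV_n := N *m col_mx 0 (const_mx 1).
  have : col_mx A (active_mx v) *m d = col_mx 0 (const_mx 1).
    by rewrite mulmxA AN mul1mx.
  rewrite mul_col_mx => /eq_col_mx[Ad vd].
  have d1 j : v j 0 = 0 -> d j 0 = 1.
    by move=> /(active_mxE d)[r <-]; rewrite vd mxE.
  exists d; split=> //; first by move=> j /d1 ->.
  left; rewrite dotpE (bigD1 i) //=; apply: ltr_pwDl.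
    by rewrite d1 // mulr1; have := sv i; rewrite vi addr0.
  apply: sumr_ge0 => j _.
  case: (hadamard_eq0 j vs) => [vj|->]; last by rewrite mul0r.
  by rewrite d1 // mulr1; have := sv j; rewrite vj addr0 => /ltW.
- have : kermx A^T != 0.
    rewrite kermx_eq0 -row_leq_rank -ltnNge mxrank_tr.
    exact: leq_ltn_trans (rank_leq_row A) ltkn.
  move=> /rowV0Pn[w /sub_kermxP wA w0].
  have Aw : A *m w^T = 0 by rewrite -[A]trmxK -trmx_mul wA trmx0.
  exists w^T; split=> //.
    by move=> i vi; case: v_neq0; exists i.
  right; split.
  + by apply: (dotp_complementary vs) => i vi; case: v_neq0; exists i.
  + by apply: contra_neq w0 => w0; rewrite -[w]trmxK w0 trmx0.
  + rewrite mem_colker mul_col_mx Aw.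
    suff -> : active_mx v *m w^T = 0 by rewrite col_mx0.
    apply/matrixP => r; case: v_neq0; exists (enum_val r).
    by have := enum_valP r; rewrite inE => /eqP.
Qed.

(** * The Schur complement of a saddle point matrix *)

(** If [(a, b)] is in the left kernel, then [C a^T = 0] and
[a H a^T = - b C a^T = 0], so that [a = 0] by definiteness; then [b C = 0], and
[b = 0] because the rows of [C] are independent. *)
Lemma saddle_mx_unit (R : realType) m k (H : 'M[R]_m) (C : 'M[R]_(k, m)) :
  row_free C ->
  (forall u : 'cV_m, C *m u = 0 -> u != 0 -> quad_form H u < 0) ->
  block_mx H C^T C 0 \in unitmx.
Proof.
move=> Cfree Hneg; rewrite -row_free_unit; apply: inj_row_free => w.
rewrite -[w]hsubmxK; move: (lsubmx w) (rsubmx w) => a b.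
rewrite mul_row_block mulmx0 addr0 -row_mx0 => /eq_row_mx[aHbC aC].
have Ca : C *m a^T = 0 by rewrite -[C]trmxK -trmx_mul aC trmx0.
have a0 : a = 0.
  apply/eqP/negPn/negP => a_neq0.
  have aT_neq0 : a^T != 0.
    by apply: contra_neq a_neq0 => aT; rewrite -[a]trmxK aT trmx0.
  have := Hneg _ Ca aT_neq0; rewrite /quad_form trmxK.
  have /eqP := aHbC; rewrite addr_eq0 => /eqP ->.
  by rewrite mulNmx -mulmxA Ca mulmx0 oppr0 mxE ltxx.
move: aHbC; rewrite a0 mul0mx add0r => /eqP.
by rewrite mulmx_free_eq0 // => /eqP ->; rewrite row_mx0.
Qed.

(** Let [(eta, mu)] solve [H eta + C^T mu = - M12^T xi] and [C eta = - D xi].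
Both quadratic forms then equal
[xi^T M11 xi + xi^T M12 eta + xi^T D^T mu]: on the left by eliminating [H eta]
and then [C eta], on the right by substituting [(eta, mu)] for the product
with the inverse. *)
Lemma schur_lift (R : realType) n m k (M11 : 'M[R]_n) (M12 : 'M[R]_(n, m))
    (H : 'M[R]_m) (C : 'M[R]_(k, m)) (D : 'M[R]_(k, n)) (xi : 'cV[R]_n) :
  block_mx H C^T C 0 \in unitmx ->
  exists eta, D *m xi + C *m eta = 0 /\
    quad_form (block_mx M11 M12 M12^T H) (col_mx xi eta) =
    quad_form (M11 - row_mx M12 D^T *m invmx (block_mx H C^T C 0)
                     *m col_mx M12^T D) xi.
Proof.
move=> Ku; set K := block_mx H _ _ _ in Ku *.
pose w := - (invmx K *m (col_mx M12^T D *m xi)).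
pose eta := usubmx w; pose mu := dsubmx w.
have wE : w = col_mx eta mu by rewrite vsubmxK.
have : K *m w = - (col_mx M12^T D *m xi) by rewrite mulmxN mulKVmx.
rewrite wE mul_block_col mul0mx addr0 mul_col_mx opp_col_mx => /eq_col_mx[He Ce].
exists eta; split; first by rewrite Ce subrr.
rewrite /quad_form [in RHS]mulmxBr mulmxBl.
have -> : xi^T *m (row_mx M12 D^T *m invmx K *m col_mx M12^T D) *m xi =
    - (xi^T *m (row_mx M12 D^T *m col_mx eta mu)).
  by rewrite -wE /w !mulmxN opprK !mulmxA.
rewrite opprK mul_row_col tr_col_mx.
rewrite -[_ *m block_mx _ _ _ _ *m _]mulmxA mul_block_col mul_row_col.
have -> : H *m eta = - (M12^T *m xi) - C^T *m mu by rewrite -He addrK.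
rewrite addrA subrr add0r mulmxN mulmxA -trmx_mul Ce linearN mulNmx opprK /=.
by rewrite trmx_mul !mulmxDr !mulmxA addrA.
Qed.

Lemma restrict_posdef (R : realType) n (M : 'M[R]_n) (T : {vspace 'cV[R]_n})
    (v : 'cV[R]_n) :
  posdef (restrict_form M T) -> v \in T -> v != 0 -> 0 < quad_form M v.
Proof.
move=> Mpd vT v0.
pose a : 'cV_(\dim T) := \col_j coord (vbasis T) j v.
have va : v = basis_mx T *m a.
  rewrite {1}(coord_vbasis vT); apply/matrixP => i j.
  rewrite ord1 summxE !mxE; apply: eq_bigr => r _.
  by rewrite !mxE mulrC.
have a0 : a != 0 by apply: contra_neq v0 => a0; rewrite va a0 mulmx0.
have := Mpd a a0; rewrite /quad_form /restrict_form.
by rewrite va trmx_mul !mulmxA.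
Qed.

(** * The saddle point *)

Theorem corollary2p27 (R : realType) (n m p q : nat) (P : minmaxQP R n m p q)
    (Q11_psd : sym_possemidef (Q11 P)) (Q22_psd : sym_possemidef (Q22 P))
    (ltpn : (p < n)%N) (ltqm : (q < m)%N)
    (S_neq0 : forall x, feasX P x -> argmaxY P x !=set0)
    (x : 'cV[R]_n) (y : 'cV[R]_m)
    (xX : feasX P x) (yS : argmaxY P x y)
    (y_inner : inner_nondegenerate P x y)
    (x_stat : stationary P x y)
    (x_outer : outer_nondegenerate P x y)
    (Q11'_pd : posdef (restrict_form (Q11' P y) (tangentX P x))) :
  local_saddle P (col_mx x y).
Proof.
have [symQ11 _] := Q11_psd; have [symQ22 _] := Q22_psd.
have symQ : (Qmx P)^T = Qmx P.
  by rewrite /Qmx tr_block_mx linearN /= symQ11 symQ22 trmxK.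
have zO : Omega P (col_mx x y) by rewrite /Omega /= col_mxKu col_mxKd; case: yS.
have [_ ilicq [lI' [sI' [innerKKT' iscs]]] isosc] := y_inner.
have [_ _ olicq [lO [sO [lI [sI [[_ _ outerKKT innerKKT] oscs]]]]] _] := x_outer.
have [gradx _ xsO _ _] := outerKKT.
have [grady _ ysI _ _] := innerKKT.
have [grady' _ ysI' _ _] := innerKKT'.
pose gx := Q11 P *m x + Q12 P *m y + cx P.
pose gy := - Q22 P *m y + (Q12 P)^T *m x + cy P.
have gradE : Qmx P *m col_mx x y + cvec P = col_mx gx gy.
  by rewrite mul_block_col add_col_mx [(Q12 P)^T *m x + _]addrC.
have crit : Qmx P *m col_mx x y + cvec P + (Amx P)^T *m col_mx lO lI
    + col_mx (- sO) sI = 0.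
  rewrite gradE tr_block_mx trmx0 mul_block_col mul0mx add0r.
  rewrite !add_col_mx grady addrA [gx + _ + _]addrAC gradx.
  by rewrite col_mx0.
split.
- split=> //; exists (col_mx lO lI), (col_mx (- sO) sI); split=> //.
    by case/OmegaE: zO.
  apply/matrixP => i j; rewrite ord1 [LHS]mxE [RHS]mxE.
  case: (split_ordP i) => k ->; rewrite ?(col_mxEu, col_mxEd).
    rewrite mxE; case: (hadamard_eq0 k xsO) => ->.
      by rewrite mul0r.
    by rewrite oppr0 mulr0.
  by case: (hadamard_eq0 k ysI) => ->; rewrite ?mul0r ?mulr0.
- have [eta [Beta eta0 esc]] := escape_direction ltqm ilicq ysI' iscs.
  apply: (@not_local_minimal_of_descent _ _ _ _ _ _ _ (col_mx 0 eta)) => //.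
    split; first by rewrite mul_block_col !mulmx0 mul0mx Beta !addr0 col_mx0.
    move=> i; case: (split_ordP i) => k ->; rewrite !(col_mxEu, col_mxEd).
      by rewrite mxE.
    exact: eta0.
  rewrite gradE dotp_col_mx {1 3}/dotp mulmx0 mxE !add0r.
  (* The slope only involves the gradient in [y], so it can be read off the
     strictly complementary inner multiplier [sI'] instead of [sI]. *)
  rewrite (dotp_multiplier grady' Beta) oppr_lt0.
  case: esc => [|[-> eta_neq0 etaT]]; [by left|right; rewrite oppr0; split=> //].
  have := isosc _ etaT eta_neq0.
  rewrite /quad_form /Qmx tr_col_mx mul_row_block trmx0 !mul0mx !add0r.
  by rewrite mul_row_col mulmx0 add0r.
- have [xi [Axi xi0 esc]] := escape_direction ltpn olicq xsO oscs.
  have Kunit : inner_KKT_mx P y \in unitmx.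
    rewrite /inner_KKT_mx -tr_col_mx; apply: saddle_mx_unit.
      exact: col_mx_row_free.
    by move=> u Cu; apply: isosc; rewrite mem_colker Cu.
  move: Kunit; rewrite /inner_KKT_mx -tr_col_mx => Kunit.
  have [eta []] := schur_lift (Q11 P) (Q12 P) (col_mx (AI P) 0) xi Kunit.
  rewrite !mul_col_mx mul0mx add_col_mx add0r -[X in _ = X]col_mx0.
  move=> /eq_col_mx[ABeta Eeta] Qxieta.
  have eta0 j : y j 0 = 0 -> eta j 0 = 0 by exact: active_mx_eq0.
  have Ad : Amx P *m col_mx xi eta = 0.
    by rewrite mul_block_col mul0mx addr0 Axi ABeta col_mx0.
  apply: (@not_local_maximal_of_ascent _ _ _ _ _ _ _ (col_mx xi eta)) => //.
    split=> // i; case: (split_ordP i) => k ->; rewrite !(col_mxEu, col_mxEd).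
      exact: xi0.
    by move=> /eta0 ->.
  (* As [eta] vanishes on the active bounds of [y], the inner multiplier drops
     out and the slope is that of the outer multiplier along [xi]. *)
  rewrite (dotp_multiplier crit Ad) dotp_col_mx (dotp_complementary ysI eta0).
  have -> : dotp (- sO) xi = - dotp sO xi by rewrite /dotp linearN mulNmx mxE.
  rewrite addr0 opprK.
  case: esc => [|[-> xi_neq0 xiT]]; [by left|right; split=> //].
  rewrite Qxieta tr_col_mx trmx0.
  have := restrict_posdef Q11'_pd xiT xi_neq0.
  by rewrite /Q11' /inner_KKT_mx tr_col_mx.
Qed.
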